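(* Let $X$ be the ARH(1) process described in the context, with $k_n$ a truncation parameter ($k_n\to\infty$, $k_n/n<1$) such that, for some $\beta>1/2$, $\sqrt{k_n}\,\Lambda_{k_n}=o\left(n^{1/4}/(\ln(n))^{\beta}\right)$. Assume Assumptions A1, A2, A3 and A4 hold and that $\rho$ is a trace operator. Suppose $M_n$ is a sequence with $\|\mathcal{D}_n\mathcal{C}_n^{-1}-D_XC_X^{-1}\|_{\mathcal{L}(H)}=\mathcal{O}(M_n)$ almost surely, and $\Lambda^{\rho}_{k_n}=o(1/M_n)$ as $n\to\infty$. Then, as $n\to\infty$, $$\sup_{1\le j\le k_n}\|\psi_{n,j}-\psi'_{n,j}\|_H\to0\ \text{a.s.},\qquad \sup_{1\le j\le k_n}\|\widetilde{\psi}_{n,j}-\widetilde{\psi}'_{n,j}\|_H\to0\ \text{a.s.},$$ where $\psi'_{n,j}=\mathrm{sgn}\langle\psi_{n,j},\psi_j\rangle_H\,\psi_j$ and $\widetilde{\psi}'_{n,j}=\mathrm{sgn}\langle\widetilde\psi_{n,j},\widetilde\psi_j\rangle_H\,\widetilde\psi_j$, with $\mathrm{sgn}(a)=\mathbf{1}_{a\ge0}-\mathbf{1}_{a<0}$.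
   Context: $H$ is a real separable Hilbert space and $\mathcal{L}(H)$ is the space of bounded linear operators on $H$ with the operator norm. $X=\{X_n,\ n\in\mathbb{Z}\}$ is a zero-mean ARH(1) process: $X_n=\rho(X_{n-1})+\varepsilon_n$, where $\rho\in\mathcal{L}(H)$ satisfies $\|\rho^k\|_{\mathcal{L}(H)}<1$ for all $k\ge k_0$, for some $k_0$; $\varepsilon$ is an $H$-valued strong white noise uncorrelated with the initial condition, and $X$ is the unique stationary solution. For $x,y\in H$, $(x\otimes y)(f)=\langle x,f\rangle_H\, y$. $C_X=\mathrm{E}[X_0\otimes X_0]$ has eigenvalues $C_1\ge C_2\ge\dots$ with orthonormal eigenvectors $\phi_j$; $D_X=\mathrm{E}[X_0\otimes X_1]$, and $\rho=D_XC_X^{-1}$. $\mathcal{C}_n=\frac1n\sum_{i=0}^{n-1}X_i\otimes X_i$ has eigenvalues $C_{n,1}\ge\dots\ge C_{n,n}\ge0=C_{n,n+1}=\dots$ with orthonormal eigenvectors $\phi_{n,j}$; $\mathcal{C}_n^{-1}=\sum_{j:\,C_{n,j}>0}C_{n,j}^{-1}\phi_{n,j}\otimes\phi_{n,j}$. $\mathcal{D}_n=\frac{1}{n-1}\sum_{i=0}^{n-2}X_i\otimes X_{i+1}$. $\Lambda_{k_n}=\sup_{1\le j\le k_n}(C_j-C_{j+1})^{-1}$. Assumption A1: $\|X_0\|_H<M$ a.s. Assumption A2: $C_{n,k_n}>0$ a.s. Assumption A3: $C_j>0$ for all $j$, $D_X$ is nuclear, and $\rho$ is compact. Under A3, $\rho$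 has the singular value decomposition $\rho(x)=\sum_{j\ge1}\rho_j\langle x,\psi_j\rangle_H\widetilde\psi_j$, with $\rho(\psi_j)=\rho_j\widetilde\psi_j$, orthonormal right singular vectors $\psi_j$, orthonormal left singular vectors $\widetilde\psi_j$, and $|\rho_1|\ge|\rho_2|\ge\dots$. The compact operator $\mathcal{D}_n\mathcal{C}_n^{-1}$ (for $n$ large) has singular value decomposition $\mathcal{D}_n\mathcal{C}_n^{-1}(h)=\sum_{j=1}^{n}\widehat\rho_{n,j}\langle h,\psi_{n,j}\rangle_H\widetilde\psi_{n,j}$, with $\mathcal{D}_n\mathcal{C}_n^{-1}(\psi_{n,j})=\widehat\rho_{n,j}\widetilde\psi_{n,j}$ and orthonormal families $\{\psi_{n,j}\}$, $\{\widetilde\psi_{n,j}\}$. $\Lambda^{\rho}_{k_n}=\sup_{1\le j\le k_n}(|\rho_j|^2-|\rho_{j+1}|^2)^{-1}$ (assumed finite). Assumption A4: $\sup_{j\ge1}|\rho_j|+\sup_{j\ge1}|\widehat\rho_{n,j}|\le 1$. *)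

(* Defs.v *)
From HB Require Import structures.
From mathcomp Require Import all_boot all_order all_algebra.
From mathcomp Require Import all_classical all_reals all_analysis.
From Stdlib Require List.
Set Implicit Arguments. Unset Strict Implicit. Unset Printing Implicit Defensive.
Import Order.TTheory GRing.Theory Num.Theory.
Import numFieldNormedType.Exports.
Local Open Scope classical_set_scope.
Local Open Scope ring_scope.

Section ARH.
Context {R : realType} {H : completeNormedModType R}.

Definition hilbert_ip (ip : H -> H -> R) : Prop :=
  [/\ forall a x y z, ip (a *: x + y) z = a * ip x z + ip y z,
      forall x y, ip x y = ip y x &
      forall x, ip x x = `|x| ^+ 2].

Definition separable_H : Prop :=
  exists u : nat -> H, forall x e, 0 < e -> exists n, `|x - u n| < e.

Definition tens (ip : H -> H -> R) (x y : H) (f : H) : H := ip x f *: y.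

Definition lin_op (T : H -> H) : Prop :=
  forall a x y, T (a *: x + y) = a *: T x + T y.

Definition bounded_op (T : H -> H) : Prop :=
  lin_op T /\ exists c : R, forall x, `|T x| <= c * `|x|.

Definition opnorm (T : H -> H) : R :=
  sup [set `|T x| | x in [set x : H | `|x| <= 1]].

Definition hsum (f : nat -> H) (y : H) : Prop :=
  (fun N => \sum_(j < N) f j) @ \oo --> y.

Definition ortho_fam (ip : H -> H -> R) (e : nat -> H) : Prop :=
  forall i j, ip (e i) (e j) = (if i == j then 1 else 0).

Definition ortho_fam_upto (ip : H -> H -> R) (n : nat) (e : nat -> H) : Prop :=
  forall i j, (i < n)%N -> (j < n)%N -> ip (e i) (e j) = (if i == j then 1 else 0).

Definition compact_op (T : H -> H) : Prop :=
  compact (closure (T @` [set x : H | `|x| <= 1])).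

Definition nuclear (ip : H -> H -> R) (T : H -> H) : Prop :=
  exists a b : nat -> H,
    (exists K : R, forall N, \sum_(k < N) `|a k| * `|b k| <= K) /\
    forall x, hsum (fun k => ip (a k) x *: b k) (T x).

Definition sgn (a : R) : R := if 0 <= a then 1 else -1.

(* Lambda_k for a sequence c indexed from 0: max_{j<k} (c j - c (j+1))^-1 *)
Definition Lambda (k : nat) (c : nat -> R) : R :=
  \big[Num.max/0]_(j < k) (c j - c j.+1)^-1.

End ARH.

Section Random.
Context {R : realType} {d : measure_display} {Omega : measurableType d}
        {H : completeNormedModType R}.

(* weakly measurable H-valued random element (= Borel measurable, H separable) *)
Definition rand_elt (ip : H -> H -> R) (Y : Omega -> H) : Prop :=
  forall h, measurable_fun setT (fun w => ip (Y w) h).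

Definition cyl (ip : H -> H -> R) (Y : Omega -> H) (c : seq (H * set R)) : set Omega :=
  foldr (fun p A => A `&` [set w | p.2 (ip (Y w) p.1)]) setT c.

Definition meas_list (c : seq (H * set R)) : Prop :=
  forall p, Stdlib.Lists.List.In p c -> measurable p.2.

(* mutual independence of the sigma-algebras sigma(Y i), checked on the
   generating pi-systems of cylinder events *)
Definition indep_H (P : probability Omega R) (ip : H -> H -> R) {I : eqType}
  (Y : I -> Omega -> H) : Prop :=
  forall s : seq (I * seq (H * set R)),
    uniq (map fst s) -> (forall q, Stdlib.Lists.List.In q s -> meas_list q.2) ->
    fine (P (foldr (fun q A => A `&` cyl ip (Y q.1) q.2) setT s)) =
    \prod_(q <- s) fine (P (cyl ip (Y q.1) q.2)).

(* identical distribution (laws agree on the cylinder pi-system) *)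
Definition ident_distr (P : probability Omega R) (ip : H -> H -> R) {I : Type}
  (Y : I -> Omega -> H) : Prop :=
  forall i j (c : seq (H * set R)), meas_list c -> P (cyl ip (Y i) c) = P (cyl ip (Y j) c).

Definition Cemp (ip : H -> H -> R) (X : int -> Omega -> H) (n : nat) (w : Omega) (f : H) : H :=
  n%:R^-1 *: \sum_(i < n) tens ip (X (Posz i) w) (X (Posz i) w) f.

Definition Demp (ip : H -> H -> R) (X : int -> Omega -> H) (n : nat) (w : Omega) (f : H) : H :=
  (n.-1)%:R^-1 *: \sum_(i < n.-1) tens ip (X (Posz i) w) (X (Posz i.+1) w) f.

(* C_n^{-1} = sum_{j : C_{n,j} > 0} C_{n,j}^{-1} phi_{n,j} ⊗ phi_{n,j}; only j < n can be > 0 *)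
Definition Cinv (ip : H -> H -> R) (Cn : nat -> nat -> Omega -> R)
  (phin : nat -> nat -> Omega -> H) (n : nat) (w : Omega) (f : H) : H :=
  \sum_(j < n | 0 < Cn n j w) (Cn n j w)^-1 *: tens ip (phin n j w) (phin n j w) f.

End Random.

(* Main.v *)
(** The sample space plays no role: on the almost sure event, [T := rho] and
    [T' := D_n C_n^{-1}] are two fixed operators with
    [||T - T'|| <= delta = O(M_n)].  The right singular vectors are the
    eigenvectors of [T^* T], and A4 gives [||T^* T - T'^* T'|| <= delta], so
    Weyl's inequality and a spectral gap argument bound the distance from
    [psin n j] to [+- psi j] by [4 * delta / gap j].  The maximum over [j < k n]
    is then at most [4 * delta * Lambda (k n)], which tends to [0].  The left
    singular vectors are the right singular vectors of the adjoints, and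
    [||T^* - T'^*|| = ||T - T'||]. *)
Require Import Defs.
From HB Require Import structures.
From mathcomp Require Import all_boot all_order all_algebra.
From mathcomp Require Import all_classical all_reals all_analysis.
From mathcomp Require Import ring lra.
Set Implicit Arguments. Unset Strict Implicit. Unset Printing Implicit Defensive.
Import Order.TTheory GRing.Theory Num.Theory.
Import numFieldNormedType.Exports.
Local Open Scope classical_set_scope.
Local Open Scope ring_scope.

(** * Inner product algebra, Cauchy-Schwarz and Bessel *)

Section InnerProduct.
Context {R : realType} {H : completeNormedModType R} {ip : H -> H -> R}
        (hip : hilbert_ip ip).

Lemma ipC x y : ip x y = ip y x.
Proof. by case: hip. Qed.

Lemma ipxx x : ip x x = `|x| ^+ 2.
Proof. by case: hip. Qed.

Lemma ipDl x y z : ip (x + y) z = ip x z + ip y z.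
Proof. by case: hip => h _ _; have := h 1 x y z; rewrite scale1r mul1r. Qed.

Lemma ip0l z : ip 0 z = 0.
Proof. by apply: (addIr (ip 0 z)); rewrite -ipDl !add0r. Qed.

Lemma ipZl a x z : ip (a *: x) z = a * ip x z.
Proof. by case: hip => h _ _; have := h a x 0 z; rewrite ip0l !addr0. Qed.

Lemma ipNl x z : ip (- x) z = - ip x z.
Proof. by rewrite -scaleN1r ipZl mulN1r. Qed.

Lemma ipBl x y z : ip (x - y) z = ip x z - ip y z.
Proof. by rewrite ipDl ipNl. Qed.

Lemma ipDr x y z : ip z (x + y) = ip z x + ip z y.
Proof. by rewrite !(ipC z) ipDl. Qed.

Lemma ip0r z : ip z 0 = 0.
Proof. by rewrite ipC ip0l. Qed.

Lemma ipZr a x z : ip z (a *: x) = a * ip z x.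
Proof. by rewrite !(ipC z) ipZl. Qed.

Lemma ipBr x y z : ip z (x - y) = ip z x - ip z y.
Proof. by rewrite !(ipC z) ipBl. Qed.

Lemma ip_suml I (r : seq I) (Q : pred I) (F : I -> H) z :
  ip (\sum_(i <- r | Q i) F i) z = \sum_(i <- r | Q i) ip (F i) z.
Proof. by apply: (big_morph (ip^~ z)) => [x y|]; rewrite ?ipDl ?ip0l. Qed.

Lemma ip_sumr I (r : seq I) (Q : pred I) (F : I -> H) z :
  ip z (\sum_(i <- r | Q i) F i) = \sum_(i <- r | Q i) ip z (F i).
Proof. by rewrite ipC ip_suml; apply: eq_bigr => i _; rewrite ipC. Qed.

Lemma cauchy_schwarz x y : `|ip x y| <= `|x| * `|y|.
Proof.
have [->|y0] := eqVneq y 0; first by rewrite ip0r !normr0 mulr0.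
have yp : 0 < `|y| ^+ 2 by rewrite exprn_gt0 // normr_gt0.
rewrite -(@ler_pXn2r _ 2) ?nnegrE ?mulr_ge0 // real_normK ?num_real // exprMn.
(* This vector is |y|^2 times the component of [x] orthogonal to [y]; the scaling avoids a
   division. *)
have : 0 <= ip (`|y| ^+ 2 *: x - ip x y *: y) (`|y| ^+ 2 *: x - ip x y *: y).
  by rewrite ipxx sqr_ge0.
rewrite !(ipBl, ipBr, ipZl, ipZr) (ipC y x) !ipxx => h.
rewrite -(ler_pM2l yp) -subr_ge0; apply: le_trans h _.
by rewrite le_eqVlt; apply/orP; left; apply/eqP; ring.
Qed.

Lemma cvg_ipr (u : nat -> H) y z :
  u @ \oo --> y -> (fun N => ip z (u N)) @ \oo --> ip z y.
Proof.
move=> /cvgrPdist_lt uy; apply/cvgrPdist_lt => e e0.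
have z1 : 0 < `|z| + 1 by rewrite ltr_pwDr.
near=> N.
rewrite -ipBr (le_lt_trans (cauchy_schwarz _ _)) //.
apply: (@le_lt_trans _ _ ((`|z| + 1) * `|y - u N|)).
  by rewrite ler_wpM2r // lerDl.
rewrite mulrC -ltr_pdivlMr //; near: N.
by apply: uy; rewrite divr_gt0.
Unshelve. all: by end_near. Qed.

(** The filter [Q] lets heads and tails of a sum be handled over one index range. *)
Lemma ip_ortho_sum n (e : nat -> H) (Q : pred nat) (a : nat -> R) j :
  ortho_fam_upto ip n e -> (j < n)%N ->
  ip (e j) (\sum_(i < n | Q i) a i *: e i) = if Q j then a j else 0.
Proof.
move=> oe jn; rewrite ip_sumr big_mkcond /= (bigD1 (Ordinal jn)) //= big1.
  by rewrite addr0 ipZr oe // eqxx mulr1.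
move=> i ij; case: ifP => // _; rewrite ipZr oe // ifF ?mulr0 //.
by apply: contraNF ij => /eqP ji; apply/eqP/val_inj.
Qed.

Lemma norm_ortho_sum n (e : nat -> H) (Q : pred nat) (a : nat -> R) :
  ortho_fam_upto ip n e ->
  `|\sum_(i < n | Q i) a i *: e i| ^+ 2 = \sum_(i < n | Q i) a i ^+ 2.
Proof.
move=> oe; rewrite -ipxx ip_suml; apply: eq_bigr => i Qi.
by rewrite ipZl ip_ortho_sum // Qi.
Qed.

Lemma bessel n (e : nat -> H) x :
  ortho_fam_upto ip n e -> \sum_(i < n) ip (e i) x ^+ 2 <= `|x| ^+ 2.
Proof.
move=> oe; set p := \sum_(i < n) ip (e i) x *: e i.
have pp : ip p p = \sum_(i < n) ip (e i) x ^+ 2.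
  by rewrite ipxx (norm_ortho_sum xpredT (fun i => ip (e i) x) oe).
have px : ip p x = \sum_(i < n) ip (e i) x ^+ 2.
  by rewrite ip_suml; apply: eq_bigr => i _; rewrite ipZl.
have : 0 <= ip (x - p) (x - p) by rewrite ipxx sqr_ge0.
by rewrite !(ipBl, ipBr) (ipC x p) px pp ipxx; lra.
Qed.

(* The [e i] with [i < n] are the leading eigenvectors of [T^* T], for the
   eigenvalues [s i ^+ 2], stated without mentioning the adjoint of [T]. *)
Definition singular_upto n (T : H -> H) (s : nat -> R) (e : nat -> H) : Prop :=
  [/\ lin_op T, ortho_fam_upto ip n e,
      forall i j, (i <= j)%N -> (j < n)%N -> `|s j| <= `|s i|,
      forall i y, (i < n)%N -> ip (T (e i)) (T y) = s i ^+ 2 * ip (e i) y &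
      forall m v, (m < n)%N -> (forall i, (i < m)%N -> ip (e i) v = 0) ->
        `|T v| <= `|s m| * `|v|].

(** * Linear operators and singular value expansions *)

Lemma lin_op0 (T : H -> H) : lin_op T -> T 0 = 0.
Proof.
move=> lT; have := lT 1 0 0; rewrite !scale1r => h.
by apply: (addIr (T 0)); rewrite -h !add0r.
Qed.

Lemma lin_opD {T : H -> H} x y : lin_op T -> T (x + y) = T x + T y.
Proof. by move=> lT; have := lT 1 x y; rewrite !scale1r. Qed.

Lemma lin_opZ {T : H -> H} a x : lin_op T -> T (a *: x) = a *: T x.
Proof. by move=> lT; have := lT a x 0; rewrite (lin_op0 lT) !addr0. Qed.

Lemma lin_opB {T : H -> H} x y : lin_op T -> T (x - y) = T x - T y.
Proof. by move=> lT; rewrite (lin_opD _ _ lT) -scaleN1r (lin_opZ _ _ lT) scaleN1r. Qed.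

Lemma lin_op_sum {T : H -> H} I (r : seq I) (Q : pred I) (F : I -> H) :
  lin_op T -> T (\sum_(i <- r | Q i) F i) = \sum_(i <- r | Q i) T (F i).
Proof.
by move=> lT; apply: (big_morph T) => [x y|]; [exact: lin_opD|exact: lin_op0].
Qed.

(** Terms below [m] vanish, the others carry a factor at most [s m ^+ 2], and Bessel bounds what
    remains. The case [n <= m] is allowed, so the bound applies to every partial sum of a series. *)
Lemma norm_svd_sum_le n (s : nat -> R) (e f : nat -> H) m v :
  ortho_fam_upto ip n e -> ortho_fam_upto ip n f ->
  (forall i, (m <= i < n)%N -> `|s i| <= `|s m|) ->
  (forall i, (i < m)%N -> ip (e i) v = 0) ->
  `|\sum_(i < n) s i *: tens ip (e i) (f i) v| <= `|s m| * `|v|.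
Proof.
move=> oe of_ ss ev.
rewrite -(@ler_pXn2r _ 2) ?nnegrE ?mulr_ge0 // exprMn.
under eq_bigr do rewrite /tens scalerA.
rewrite (norm_ortho_sum xpredT (fun i => s i * ip (e i) v) of_).
apply: (@le_trans _ _ (`|s m| ^+ 2 * \sum_(i < n) ip (e i) v ^+ 2)).
  rewrite mulr_sumr; apply: ler_sum => i _; rewrite exprMn.
  have [im|mi] := ltnP i m; first by rewrite ev // expr0n !mulr0.
  rewrite ler_wpM2r ?sqr_ge0 // -(real_normK (num_real (s i))).
  by rewrite ler_pXn2r ?nnegrE // ss // mi /=.
by rewrite ler_wpM2l ?sqr_ge0 // bessel.
Qed.

Lemma svd_sum_basis n (s : nat -> R) (e f : nat -> H) i :
  ortho_fam_upto ip n e -> (i < n)%N ->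
  \sum_(j < n) s j *: tens ip (e j) (f j) (e i) = s i *: f i.
Proof.
move=> oe iN; rewrite (bigD1 (Ordinal iN)) //= big1 ?addr0; last first.
  move=> j ji; rewrite /tens oe // ifF ?scale0r ?scaler0 //.
  by apply: contraNF ji => /eqP ji; apply/eqP/val_inj.
by rewrite /tens oe // eqxx scale1r.
Qed.

Lemma singular_finite n (T : H -> H) (s : nat -> R) (e f : nat -> H) :
  ortho_fam_upto ip n e -> ortho_fam_upto ip n f ->
  (forall i j, (i <= j)%N -> (j < n)%N -> `|s j| <= `|s i|) ->
  (forall x, T x = \sum_(i < n) s i *: tens ip (e i) (f i) x) ->
  singular_upto n T s e.
Proof.
move=> oe of_ ss TE.
have fT i y : (i < n)%N -> ip (f i) (T y) = s i * ip (e i) y.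
  move=> iN; rewrite TE; under eq_bigr do rewrite /tens scalerA.
  by rewrite (ip_ortho_sum xpredT (fun i => s i * ip (e i) y)).
split=> //.
- move=> a x y; rewrite !TE scaler_sumr -big_split /=; apply: eq_bigr => i _.
  by rewrite /tens ipDr ipZr !scalerA -scalerDl; congr (_ *: _); ring.
- by move=> i y iN; rewrite {1}TE svd_sum_basis // ipZl fT //; ring.
- move=> m v mN ev; rewrite TE; apply: norm_svd_sum_le => // i /andP[mi iN].
  exact: ss.
Qed.

Lemma ortho_famW n e : ortho_fam ip e -> ortho_fam_upto ip n e.
Proof. by move=> oe i j _ _; apply: oe. Qed.

Lemma ip_hsum (u : nat -> H) y z :
  hsum u y -> (fun N => \sum_(j < N) ip z (u j)) @ \oo --> ip z y.
Proof.
move=> /(cvg_ipr (z := z)); rewrite [X in X @ _](_ : _ = fun N => \sum_(j < N) ip z (u j)) //.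
by apply/funext => N; rewrite ip_sumr.
Qed.

(** Paired with [f i], or evaluated at [e i], the partial sums are constant from [i.+1] on, so the
    limit can be read off. Linearity and the tail bound pass to the limit. *)
Lemma singular_hsum n (T : H -> H) (s : nat -> R) (e f : nat -> H) :
  ortho_fam ip e -> ortho_fam ip f ->
  {homo (fun i => `|s i|) : i j / (i <= j)%N >-> j <= i} ->
  (forall x, hsum (fun i => s i *: tens ip (e i) (f i) x) (T x)) ->
  singular_upto n T s e.
Proof.
move=> oe of_ ss TE.
have fT i y : ip (f i) (T y) = s i * ip (e i) y.
  have := ip_hsum (z := f i) (TE y) => h.
  apply: (cvg_unique _ h) => //.
  apply: cvg_near_cst; exists i.+1 => // N /= iN.
  rewrite -ip_sumr; under eq_bigr do rewrite /tens scalerA.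
  by rewrite (ip_ortho_sum xpredT (fun i => s i * ip (e i) y) (ortho_famW (n := N) of_)).
have Te i : T (e i) = s i *: f i.
  apply: (cvg_unique _ (TE (e i))) => //.
  apply: cvg_near_cst; exists i.+1 => // N /= iN.
  by rewrite svd_sum_basis //; apply: ortho_famW.
split=> //.
- move=> a x y; apply: (cvg_unique _ (TE (a *: x + y))) => //.
  pose p z N := \sum_(j < N) s j *: tens ip (e j) (f j) z.
  have h := cvgD (cvgZr (k := a) (TE x)) (TE y).
  suff pE : p (a *: x + y) = fun N => a *: p x N + p y N.
    by rewrite -/(p (a *: x + y)) pE; exact: h.
  apply/funext => N; rewrite scaler_sumr -big_split /=; apply: eq_bigr => i _.
  by rewrite /tens ipDr ipZr !scalerA -scalerDl; congr (_ *: _); ring.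
- by move=> i j ij _; apply: ss.
- by move=> i y iN; rewrite Te ipZl fT; ring.
- move=> m v mN ev; apply: (cvgr_to_le (cvg_norm (TE v))).
  apply: nearW => N; apply: norm_svd_sum_le => //; try exact: ortho_famW.
  by move=> i /andP[mi _]; apply: ss.
Qed.

(** * Comparison of singular values *)

(** Dimension count: a matrix with [m.+1] rows and [m] columns has a nonzero left kernel vector. *)
Lemma exists_ortho_comb m (e g : nat -> H) :
  exists a : nat -> R, (exists2 i, (i < m.+1)%N & a i != 0) /\
    forall l, (l < m)%N -> ip (g l) (\sum_(i < m.+1) a i *: e i) = 0.
Proof.
pose A : 'M[R]_(m.+1, m) := \matrix_(i, l) ip (g l) (e i).
have : kermx A != 0.
  rewrite kermx_eq0 /row_free; apply/eqP => rA.
  by have := rank_leq_col A; rewrite rA ltnn.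
move=> /rowV0Pn[v /sub_kermxP vA v0].
exists (fun i => v 0 (inord i)); split.
  have /matrix0Pn[i [j vij]] := v0; exists j => //.
  by rewrite inord_val -(ord1 i).
move=> l lm; have := congr1 (fun B : 'rV_m => B 0 (Ordinal lm)) vA.
rewrite !mxE => h; rewrite ip_sumr -[RHS]h; apply: eq_bigr => i _.
by rewrite ipZr inord_val mxE.
Qed.

(** The squared norm of the image is the sum of [s i ^+ 2 * a i ^+ 2], and [s m] is the smallest
    modulus involved. This complements the upper bound on tails in [singular_upto]. *)
Lemma singular_head_le n T s e m (a : nat -> R) :
  singular_upto n T s e -> (m < n)%N ->
  `|s m| * `|\sum_(i < m.+1) a i *: e i| <= `|T (\sum_(i < m.+1) a i *: e i)|.
Proof.
move=> [lT oe ss dT _] mn.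
have oem : ortho_fam_upto ip m.+1 e.
  by move=> i j im jm; apply: oe; apply: leq_trans mn.
rewrite -(@ler_pXn2r _ 2) ?nnegrE ?mulr_ge0 // exprMn.
rewrite -[X in _ <= X]ipxx {1}(lin_op_sum _ _ _ lT) ip_suml (norm_ortho_sum xpredT a oem).
rewrite mulr_sumr; apply: ler_sum => i _.
have im : (i < n)%N by apply: leq_trans mn.
rewrite (lin_opZ _ _ lT) ipZl dT // (ip_ortho_sum xpredT a oem) //=.
rewrite [X in _ <= X](_ : _ = s i ^+ 2 * a i ^+ 2); last by ring.
rewrite ler_wpM2r ?sqr_ge0 // -(real_normK (num_real (s i))).
by rewrite ler_pXn2r ?nnegrE // ss // -ltnS.
Qed.

(* Weyl's inequality: some combination of [e' 0], .., [e' j] is orthogonal to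
   [e 0], .., [e j.-1]. *)
Lemma singular_value_le n T T' s s' e e' j delta :
  singular_upto n T s e -> singular_upto n T' s' e' -> (j < n)%N ->
  (forall x, `|T x - T' x| <= delta * `|x|) ->
  `|s' j| <= `|s j| + delta.
Proof.
move=> hT hT' jn TT'.
have [a [[i ij ai] xe]] := exists_ortho_comb j e' e.
have oe' : ortho_fam_upto ip j.+1 e'.
  case: hT' => _ oe _ _ _ i1 i2 im jm.
  by apply: oe; apply: leq_trans jn.
have h1 := singular_head_le a hT' jn.
set x := \sum_(_ < _) _ in xe h1.
have x0 : 0 < `|x|.
  rewrite normr_gt0; apply/eqP => x0; move/eqP: ai; apply.
  by have := ip_ortho_sum xpredT a oe' ij; rewrite -/x x0 ip0r.
rewrite -(ler_pM2r x0) (le_trans h1) // mulrDl.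
case: hT => _ _ _ _ tT.
have := tT j x jn xe; have := TT' x; have := ler_distD (T x) (T' x) 0.
rewrite !subr0 (distrC (T' x)); lra.
Qed.

(** * Perturbation of singular vectors *)

Lemma singular_bound n T s e x : singular_upto n T s e -> (0 < n)%N -> `|T x| <= `|s 0%N| * `|x|.
Proof. by move=> [_ _ _ _ tT] n0; apply: tT. Qed.

(** With [c := ip x y] the left side equals 2 (1 - |c|), and |c| >= c^2 because |c| <= 1. *)
Lemma norm_sub_sgn_le x y : `|x| = 1 -> `|y| = 1 ->
  `|x - sgn (ip x y) *: y| ^+ 2 <= 2 * (1 - ip x y ^+ 2).
Proof.
move=> x1 y1; rewrite -ipxx !(ipBl, ipBr, ipZl, ipZr) (ipC y x) !ipxx x1 y1 !expr1n.
have := cauchy_schwarz x y; rewrite x1 y1 mulr1 ler_norml => /andP[].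
by move: (ip x y) => c h1 h2; rewrite /sgn; case: (leP 0 c) => h; nra.
Qed.

(* With [x := e' j] split along [e 0 .. e j.-1], [e j] and the orthogonal
   complement as [x = u + c *: e j + v], the form
   [ip (T x) (T y) - s j ^+ 2 * ip x y] at [y := u - v] is at least
   [g * `|y| ^+ 2], and at most [2 * delta * `|y|] since [x] is an eigenvector
   of [T'^* T']. *)
Lemma singular_vector_perturbation n T T' s s' e e' j delta g :
  singular_upto n T s e -> singular_upto n T' s' e' -> (j.+1 < n)%N ->
  `|s 0%N| + `|s' 0%N| <= 1 ->
  (forall x, `|T x - T' x| <= delta * `|x|) ->
  0 < g -> g <= s j ^+ 2 - s j.+1 ^+ 2 ->
  (forall i, (i < j)%N -> g <= s i ^+ 2 - s j ^+ 2) ->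
  `|e' j - sgn (ip (e' j) (e j)) *: e j| <= 4 * delta / g.
Proof.
move=> hT hT' j1n ss1 TT' g0 gj gi.
have jn : (j < n)%N by apply: ltnW.
have n0 : (0 < n)%N by apply: leq_trans jn.
have TT'C x : `|T' x - T x| <= delta * `|x| by rewrite distrC.
have wl := singular_value_le hT hT' jn TT'.
have wr := singular_value_le hT' hT jn TT'C.
have bT x := singular_bound x hT n0.
have bT' x := singular_bound x hT' n0.
case: hT => lT oe smono dT tT; case: hT' => lT' oe' s'mono dT' _.
have norm1 f i : ortho_fam_upto ip n f -> (i < n)%N -> `|f i| = 1.
  move=> of_ iN; apply/eqP; rewrite -(@eqrXn2 _ 2) // expr1n -ipxx.
  by rewrite of_ // eqxx.
set x := e' j; have x1 : `|x| = 1 by apply: norm1.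
have delta0 : 0 <= delta by have := TT' x; rewrite x1 mulr1; apply: le_trans.
(* Difference of squares: the moduli differ by at most [delta] by Weyl, and they sum to at most
   1. *)
have sq_le : `|s' j ^+ 2 - s j ^+ 2| <= delta.
  rewrite -(real_normK (num_real (s j))) -(real_normK (num_real (s' j))).
  have h1 := smono _ _ (leq0n j) jn; have h2 := s'mono _ _ (leq0n j) jn.
  have : 0 <= `|s j| by []. have : 0 <= `|s' j| by [].
  move: wl wr ss1 h1 h2; move: (`|s j|) (`|s' j|) (`|s 0%N|) (`|s' 0%N|) => a b A B.
  by move=> *; rewrite ler_norml; apply/andP; split; nra.
have oej : ortho_fam_upto ip j.+1 e.
  by move=> i l il ll; apply: oe; apply: leq_trans jn.
pose a i := ip (e i) x.
(* Both [u] and [v] are cut from the range [j.+1], with the index [j] filtered out of [u], so that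
   [oej] serves for both. *)
pose u := \sum_(i < j.+1 | (i < j)%N) a i *: e i.
pose v := x - \sum_(i < j.+1 | true) a i *: e i.
have xE : x = u + a j *: e j + v.
  have -> : u = \sum_(i < j) a i *: e i by rewrite /u big_ord_narrow.
  by rewrite /v big_ord_recr /= addrCA subrr addr0.
have ev i : (i < j.+1)%N -> ip (e i) v = 0.
  by move=> ij; rewrite ipBr (ip_ortho_sum xpredT a oej) // subrr.
have eu i : (i < j.+1)%N -> ip (e i) u = if (i < j)%N then a i else 0.
  by move=> ij; rewrite (ip_ortho_sum (fun i => (i < j)%N) a oej).
have uz z : ip u z = \sum_(i < j.+1 | (i < j)%N) a i * ip (e i) z.
  by rewrite ip_suml; apply: eq_bigr => i _; rewrite ipZl.
have Tuz z : ip (T u) (T z) = \sum_(i < j.+1 | (i < j)%N) a i * (s i ^+ 2 * ip (e i) z).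
  rewrite (lin_op_sum _ _ _ lT) ip_suml; apply: eq_bigr => i ij.
  by rewrite (lin_opZ _ _ lT) ipZl dT // (ltn_trans ij).
have uv : ip u v = 0 by rewrite uz big1 // => i _; rewrite ev ?mulr0.
have Tuv : ip (T u) (T v) = 0 by rewrite Tuz big1 // => i _; rewrite ev ?mulr0.
have eju : ip (e j) u = 0 by rewrite eu // ltnn.
have ejv : ip (e j) v = 0 by rewrite ev.
have Tu_ge : (s j ^+ 2 + g) * ip u u <= ip (T u) (T u).
  rewrite Tuz uz mulr_sumr; apply: ler_sum => i ij; rewrite eu // ij.
  by have := gi _ ij; have := sqr_ge0 (a i); nra.
have Tv_le : ip (T v) (T v) <= (s j ^+ 2 - g) * ip v v.
  have := tT j.+1 v j1n ev.
  rewrite -(@ler_pXn2r _ 2) ?nnegrE ?mulr_ge0 // exprMn real_normK ?num_real //.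
  by rewrite -!ipxx => /le_trans; apply; rewrite ler_wpM2r ?ipxx ?sqr_ge0 //; lra.
clearbody u v; have [y yE] : exists y, y = u - v by exists (u - v).
have ejj : ip (e j) (e j) = 1 by rewrite oe // eqxx.
have yy : `|y| ^+ 2 = ip u u + ip v v.
  by rewrite -ipxx yE !(ipBl, ipBr) (ipC v u) uv; ring.
have xx : 1 = ip u u + a j ^+ 2 + ip v v.
  rewrite -[LHS](expr1n _ 2) -[in LHS]x1 -ipxx xE !(ipDl, ipDr, ipZl, ipZr).
  by rewrite (ipC v u) (ipC u (e j)) (ipC v (e j)) uv eju ejv ejj; ring.
have xy : ip x y = ip u u - ip v v.
  rewrite xE yE !(ipDl, ipZl, ipBr).
  by rewrite (ipC v u) uv eju ejv; ring.
have Txy : ip (T x) (T y) = ip (T u) (T u) - ip (T v) (T v).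
  rewrite {1}xE !(lin_opD _ _ lT) (lin_opZ _ _ lT) !(ipDl, ipZl) dT // yE ipBr eju ejv.
  by rewrite (lin_opB _ _ lT) !ipBr (ipC (T v) (T u)) Tuv; ring.
have lower : g * `|y| ^+ 2 <= ip (T x) (T y) - s j ^+ 2 * ip x y.
  by rewrite Txy xy yy; nra.
have upper : ip (T x) (T y) - s j ^+ 2 * ip x y <= 2 * delta * `|y|.
  (* Replacing [T] by [T'] in one slot after the other leads to the eigenvector identity for [x].
     The first two terms together cost [delta] times |y|, since the leading singular values sum to
     at most 1; the third costs as much again. *)
  have -> : ip (T x) (T y) - s j ^+ 2 * ip x y =
     ip (T x - T' x) (T y) + ip (T' x) (T y - T' y) + (s' j ^+ 2 - s j ^+ 2) * ip x y.
    by rewrite ipBl ipBr (dT' j y jn); ring.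
  have h1 := le_trans (ler_norm _) (cauchy_schwarz (T x - T' x) (T y)).
  have h2 := le_trans (ler_norm _) (cauchy_schwarz (T' x) (T y - T' y)).
  have h3 := ler_norm ((s' j ^+ 2 - s j ^+ 2) * ip x y).
  have h1' : `|T x - T' x| * `|T y| <= delta * (`|s 0%N| * `|y|).
    by apply: ler_pM => //; rewrite -[delta]mulr1 -x1.
  have h2' : `|T' x| * `|T y - T' y| <= `|s' 0%N| * (delta * `|y|).
    by apply: ler_pM => //; rewrite -[`|s' 0%N|]mulr1 -x1.
  have h3' : `|(s' j ^+ 2 - s j ^+ 2) * ip x y| <= delta * `|y|.
    by rewrite normrM; apply: ler_pM => //; rewrite -[`|y|]mul1r -x1 cauchy_schwarz.
  have h4 : (`|s 0%N| + `|s' 0%N|) * (delta * `|y|) <= delta * `|y|.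
    by rewrite ler_piMl // mulr_ge0.
  by rewrite mulrDl in h4; lra.
have y_le : `|y| <= 2 * delta / g.
  rewrite ler_pdivlMr //; have [y0|y0] := eqVneq `|y| 0.
    by rewrite y0 mul0r mulr_ge0.
  have yp : 0 < `|y| by rewrite lt_def y0 /=.
  by rewrite -(ler_pM2r yp); have := le_trans lower upper; nra.
have -> : 4 * delta / g = 2 * (2 * delta / g) by ring.
(* As |y|^2 = 1 - (a j)^2, the squared distance is at most 2 |y|^2; the factor sqrt 2 is rounded up
   to 2. *)
apply: (@le_trans _ _ (2 * `|y|)); last by rewrite ler_pM2l.
rewrite -(@ler_pXn2r _ 2) ?nnegrE ?mulr_ge0 //.
apply: le_trans (norm_sub_sgn_le x1 (norm1 _ _ oe jn)) _.
rewrite exprMn yy (ipC x (e j)) -/(a j); move: xx.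
have := sqr_ge0 `|u|; have := sqr_ge0 `|v|; rewrite -!ipxx; lra.
Qed.

(** * Adjoints through exchanged singular vectors *)

(** By Bessel the sums [b] are bounded and monotone. Their increments dominate those of the vector
    series, which is therefore Cauchy. With the two families exchanged, this yields the adjoint. *)
Lemma svd_series_cvg (s : nat -> R) (e f : nat -> H) x :
  ortho_fam ip e -> ortho_fam ip f -> (forall i, `|s i| <= `|s 0%N|) ->
  exists y, hsum (fun i => s i *: tens ip (e i) (f i) x) y.
Proof.
move=> oe of_ ss.
pose b N := \sum_(i < N) ip (e i) x ^+ 2.
have bmono : {homo b : i j / (i <= j)%N >-> i <= j}.
  apply/nondecreasing_seqP => N; rewrite /b big_ord_recr /=.
  by rewrite lerDl sqr_ge0.
have bc : cvgn b.
  apply: nondecreasing_is_cvgn => //.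
  by exists (`|x| ^+ 2) => _ [N _ <-]; apply: bessel; apply: ortho_famW.
pose F N := \sum_(i < N) s i *: tens ip (e i) (f i) x.
have FB m n : (m <= n)%N -> `|F n - F m| ^+ 2 <= `|s 0%N| ^+ 2 * (b n - b m).
  move=> mn.
  have split_sum (V : zmodType) (G : nat -> V) :
      \sum_(i < n) G i - \sum_(i < m) G i = \sum_(i < n | (m <= i)%N) G i.
    rewrite (bigID (fun i : 'I_n => (i < m)%N)) /= -big_ord_widen //.
    by rewrite addrAC subrr add0r; apply: eq_bigl => i; rewrite -leqNgt.
  rewrite /F /b (split_sum H (fun i => s i *: tens ip (e i) (f i) x)).
  rewrite (split_sum R (fun i => ip (e i) x ^+ 2)); under eq_bigr do rewrite /tens scalerA.
  rewrite (norm_ortho_sum (leq m) (fun i => s i * ip (e i) x)); last exact: ortho_famW.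
  rewrite mulr_sumr; apply: ler_sum => i _.
  rewrite exprMn ler_wpM2r ?sqr_ge0 // -(real_normK (num_real (s i))).
  by rewrite ler_pXn2r ?nnegrE.
suff : cvgn F by move=> h; exists (lim (F @ \oo)).
apply/cauchy_cvgP/cauchyP => eps eps0.
(* Adding 1 keeps the divisor positive when [s 0] vanishes. *)
have S0 : 0 < `|s 0%N| + 1 by rewrite ltr_pwDr.
have eps1 : 0 < (eps / (`|s 0%N| + 1)) ^+ 2 / 2 by rewrite divr_gt0 ?exprn_gt0 ?divr_gt0.
have /cvgrPdist_lt/(_ _ eps1)[m _ bm] := bc.
exists (F m); exists m => // n /= mn; rewrite -ball_normE /= distrC.
rewrite -(@ltr_pXn2r _ 2) ?nnegrE //; last exact: ltW.
apply: le_lt_trans (FB m n mn) _.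
have := bm m (leqnn m); have := bm n mn; rewrite /= !ltr_norml.
move=> /andP[h1 h2] /andP[h3 h4].
have bmn : 0 <= b n - b m < (eps / (`|s 0%N| + 1)) ^+ 2.
  apply/andP; split; last by lra.
  by rewrite subr_ge0; apply: bmono.
case/andP: bmn => b0 bmn.
apply: (@le_lt_trans _ _ ((`|s 0%N| + 1) ^+ 2 * (b n - b m))).
  by rewrite ler_wpM2r // ler_pXn2r ?nnegrE ?lerDl // ltW.
by rewrite -ltr_pdivlMl ?exprn_gt0 // mulrC -expr_div_n.
Qed.

Lemma adjoint_hsum (T S : H -> H) (s : nat -> R) (e f : nat -> H) x y :
  (forall x, hsum (fun i => s i *: tens ip (e i) (f i) x) (T x)) ->
  (forall y, hsum (fun i => s i *: tens ip (f i) (e i) y) (S y)) ->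
  ip y (T x) = ip x (S y).
Proof.
move=> TE SE; have h := ip_hsum (z := y) (TE x).
apply: (cvg_unique _ h) => //.
have := ip_hsum (z := x) (SE y).
suff -> : (fun N => \sum_(j < N) ip x (s j *: tens ip (f j) (e j) y)) =
          (fun N => \sum_(j < N) ip y (s j *: tens ip (e j) (f j) x)) by [].
apply/funext => N; apply: eq_bigr => i _.
by rewrite /tens !ipZr (ipC x) (ipC y); ring.
Qed.

Lemma adjoint_finite n (T S : H -> H) (s : nat -> R) (e f : nat -> H) x y :
  (forall x, T x = \sum_(i < n) s i *: tens ip (e i) (f i) x) ->
  (forall y, S y = \sum_(i < n) s i *: tens ip (f i) (e i) y) ->
  ip y (T x) = ip x (S y).
Proof.
move=> -> ->; rewrite !ip_sumr; apply: eq_bigr => i _.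
by rewrite /tens !ipZr (ipC x) (ipC y); ring.
Qed.

(** For [z := S y - S' y], moving the operators across gives |z|^2 = [ip y (T z - T' z)], which is
    at most |y| [delta] |z|. *)
Lemma adjoint_dist_le (T T' S S' : H -> H) delta :
  0 <= delta ->
  (forall x y, ip y (T x) = ip x (S y)) ->
  (forall x y, ip y (T' x) = ip x (S' y)) ->
  (forall x, `|T x - T' x| <= delta * `|x|) ->
  forall y, `|S y - S' y| <= delta * `|y|.
Proof.
move=> d0 TS TS' TT' y; set z := S y - S' y.
have [->|z0] := eqVneq z 0; first by rewrite normr0 mulr_ge0.
have zp : 0 < `|z| by rewrite normr_gt0.
rewrite -(ler_pM2r zp) -expr2 -ipxx {2}/z ipBr -TS -TS' -ipBr.
apply: le_trans (ler_norm _) _; apply: le_trans (cauchy_schwarz _ _) _.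
by rewrite -mulrA mulrCA ler_wpM2l.
Qed.

(** * Uniform bound over the leading indices, and convergence *)

Lemma bigmax_singular_vector_le n k T T' s s' e e' delta :
  singular_upto n T s e -> singular_upto n T' s' e' -> (k < n)%N ->
  `|s 0%N| + `|s' 0%N| <= 1 ->
  (forall x, `|T x - T' x| <= delta * `|x|) -> 0 <= delta ->
  (forall i, `|s i.+1| < `|s i|) ->
  \big[Num.max/0]_(j < k) `|e' j - sgn (ip (e' j) (e j)) *: e j| <=
    4 * delta * Lambda k (fun j => `|s j| ^+ 2).
Proof.
move=> hT hT' kn ss1 TT' d0 sdec; set L := Lambda _ _.
have L0 : 0 <= L by apply: bigmax_ge_id.
have smono : {homo (fun i => `|s i|) : i j / (i <= j)%N >-> j <= i}.
  by apply/nonincreasing_seqP => i; apply: ltW.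
(* The inverse of [L] is a common lower bound for all gaps up to [k], so it can play the part of [g]
   for every [j]. *)
have gap i : (i < k)%N -> 0 < L /\ L^-1 <= `|s i| ^+ 2 - `|s i.+1| ^+ 2.
  move=> ik; have di : 0 < `|s i| ^+ 2 - `|s i.+1| ^+ 2.
    by rewrite subr_gt0 ltr_pXn2r ?nnegrE.
  have Li : (`|s i| ^+ 2 - `|s i.+1| ^+ 2)^-1 <= L.
    exact: (le_bigmax _ (fun j : 'I_k => (`|s j| ^+ 2 - `|s j.+1| ^+ 2)^-1) (Ordinal ik)).
  have Lp : 0 < L by apply: lt_le_trans Li; rewrite invr_gt0.
  by split=> //; rewrite -[leRHS]invrK lef_pV2 // posrE invr_gt0.
apply: bigmax_le => [|j _]; first by rewrite !mulr_ge0.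
have [Lp gj] := gap j (ltn_ord j).
rewrite -[L]invrK; apply: (singular_vector_perturbation hT hT') => //.
- by apply: leq_ltn_trans kn.
- by rewrite invr_gt0.
- by rewrite -(real_normK (num_real (s j))) -(real_normK (num_real (s j.+1))).
- move=> i ij; have [_ gi] := gap i (ltn_trans ij (ltn_ord j)).
  rewrite -(real_normK (num_real (s j))) -(real_normK (num_real (s i))).
  apply: le_trans gi _; rewrite lerB // ler_pXn2r ?nnegrE //; exact: smono.
Qed.

(** The crude bound [B] makes the set bounded above, so that its [sup] is an upper bound. *)
Lemma opnorm_ge (A : H -> H) (B : R) x :
  lin_op A -> (forall x, `|A x| <= B * `|x|) -> `|A x| <= opnorm A * `|x|.
Proof.
move=> lA AB; have [->|x0] := eqVneq x 0.
  by rewrite (lin_op0 lA) !normr0 mulr0.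
have xp : 0 < `|x| by rewrite normr_gt0.
rewrite -ler_pdivrMr // mulrC.
have -> : `|x|^-1 * `|A x| = `|A (`|x|^-1 *: x)|.
  by rewrite (lin_opZ _ _ lA) normrZ ger0_norm // invr_ge0.
apply: ub_le_sup; last first.
  by exists (`|x|^-1 *: x) => //=; rewrite normrZ ger0_norm ?invr_ge0 // mulVf // gt_eqF.
exists `|B| => _ [z /= z1 <-]; apply: le_trans (AB z) _.
apply: le_trans (ler_norm _) _; rewrite normrM normr_id.
by rewrite ler_piMr.
Qed.

Lemma singular_vectors_cvg (T : H -> H) (s : nat -> R) (e f : nat -> H)
    (T' : nat -> H -> H) (s' : nat -> nat -> R) (e' f' : nat -> nat -> H)
    (k : nat -> nat) (M : nat -> R) (C0 : R) n0 :
  ortho_fam ip e -> ortho_fam ip f -> (forall i, `|s i.+1| < `|s i|) ->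
  (forall x, hsum (fun i => s i *: tens ip (e i) (f i) x) (T x)) ->
  (forall n, ortho_fam_upto ip n (e' n)) -> (forall n, ortho_fam_upto ip n (f' n)) ->
  (forall n i, (i.+1 < n)%N -> `|s' n i.+1| <= `|s' n i|) ->
  (forall n x, T' n x = \sum_(i < n) s' n i *: tens ip (e' n i) (f' n i) x) ->
  (forall n, (0 < n)%N -> (k n < n)%N) ->
  (forall n, (0 < n)%N -> `|s 0%N| + `|s' n 0%N| <= 1) ->
  (forall n, (n0 <= n)%N -> opnorm (fun h => T' n h - T h) <= C0 * `|M n|) ->
  (fun n => Lambda (k n) (fun j => `|s j| ^+ 2) * M n) @ \oo --> 0 ->
  (fun n => \big[Num.max/0]_(j < k n)
     `|e' n j - sgn (ip (e' n j) (e j)) *: e j|) @ \oo --> 0 /\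
  (fun n => \big[Num.max/0]_(j < k n)
     `|f' n j - sgn (ip (f' n j) (f j)) *: f j|) @ \oo --> 0.
Proof.
move=> oe of_ sdec TE oe' of' s'dec T'E kn ss1 TM LM.
have smono : {homo (fun i => `|s i|) : i j / (i <= j)%N >-> j <= i}.
  by apply/nonincreasing_seqP => i; apply: ltW.
have s'mono n i j : (i <= j)%N -> (j < n)%N -> `|s' n j| <= `|s' n i|.
  elim: j => [|j IH]; first by rewrite leqn0 => /eqP ->.
  rewrite leq_eqVlt => /orP[/eqP -> //|ij] jn.
  by apply: le_trans (s'dec _ _ jn) (IH _ (ltnW jn)).
(* [S] and [S' n] are the adjoints of [T] and [T' n]. *)
have /choice[S SE] : forall y, exists z, hsum (fun i => s i *: tens ip (f i) (e i) y) z.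
  by move=> y; apply: svd_series_cvg => // i; apply: smono.
pose S' n y := \sum_(i < n) s' n i *: tens ip (f' n i) (e' n i) y.
have hT n : singular_upto n T s e by apply: singular_hsum TE.
have hS n : singular_upto n S s f by apply: singular_hsum SE.
have hT' n : singular_upto n (T' n) (s' n) (e' n).
  by apply: (singular_finite (oe' n) (of' n) (@s'mono n)).
have hS' n : singular_upto n (S' n) (s' n) (f' n).
  by apply: (singular_finite (of' n) (oe' n) (@s'mono n)).
pose bnd n := 4 * C0 * `|Lambda (k n) (fun j => `|s j| ^+ 2) * M n|.
have bnd_cvg : bnd @ \oo --> 0.
  rewrite -(mulr0 (4 * C0)); apply: cvgMr.
  by rewrite -(@normr0 _ R); apply: cvg_norm.
have main : \forall n \near \oo,
    0 <= \big[Num.max/0]_(j < k n) `|e' n j - sgn (ip (e' n j) (e j)) *: e j| <= bnd n /\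
    0 <= \big[Num.max/0]_(j < k n) `|f' n j - sgn (ip (f' n j) (f j)) *: f j| <= bnd n.
  (* The hypotheses on [k n] and on the leading singular values require [0 < n]. *)
  exists (maxn 1 n0) => // n /=; rewrite geq_max => /andP[n_gt0 n0n].
  have dT x : `|T x - T' n x| <= C0 * `|M n| * `|x|.
    rewrite distrC; apply: le_trans (_ : opnorm (fun h => T' n h - T h) * `|x| <= _); last first.
      by rewrite ler_wpM2r // TM.
    (* The constant 1 comes from the bound on the sum of the leading singular values. *)
    apply: (@opnorm_ge (fun h => T' n h - T h) 1).
      case: (hT n) (hT' n) => lT _ _ _ _ [lT' _ _ _ _] a y z /=.
      by rewrite lT lT' scalerBr opprD addrACA.
    move=> y; apply: le_trans (ler_normB _ _) _.
    have := singular_bound y (hT n) n_gt0; have := singular_bound y (hT' n) n_gt0.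
    have := ler_wpM2r (normr_ge0 y) (ss1 n n_gt0); rewrite mulrDl; lra.
  (* The sign of [C0] is not given; testing [dT] on a unit vector settles it. *)
  have d0 : 0 <= C0 * `|M n|.
    have := dT (e 0%N).
    have -> : `|e 0%N| = 1.
      by apply/eqP; rewrite -(@eqrXn2 _ 2) // expr1n -ipxx oe eqxx.
    by rewrite mulr1; apply: le_trans.
  have dS y : `|S y - S' n y| <= C0 * `|M n| * `|y|.
    apply: (@adjoint_dist_le T (T' n)) => // {}y x.
      exact: (adjoint_hsum _ _ TE SE).
    by apply: (adjoint_finite _ _ (T'E n)).
  have bndE : 4 * (C0 * `|M n|) * Lambda (k n) (fun j => `|s j| ^+ 2) = bnd n.
    rewrite /bnd normrM [`|Lambda _ _|]ger0_norm; last exact: bigmax_ge_id.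
    by ring.
  rewrite -bndE; split; apply/andP; split; try exact: bigmax_ge_id.
    by apply: (bigmax_singular_vector_le (hT n) (hT' n)); rewrite ?kn ?ss1.
  by apply: (bigmax_singular_vector_le (hS n) (hS' n)); rewrite ?kn ?ss1.
split; apply: (squeeze_cvgr _ (cvg_cst 0) bnd_cvg);
  by apply: filterS main => n [].
Qed.

End InnerProduct.

Theorem lemma2
  (R : realType) (d : measure_display) (Omega : measurableType d)
  (P : probability Omega R)
  (H : completeNormedModType R) (ip : H -> H -> R)
  (rho : H -> H) (eps X : int -> Omega -> H)
  (CX DX : H -> H) (c : nat -> R) (phi : nat -> H)
  (rs : nat -> R) (psi psit : nat -> H)
  (Cn : nat -> nat -> Omega -> R) (phin : nat -> nat -> Omega -> H)
  (rhat : nat -> nat -> Omega -> R) (psin psitn : nat -> nat -> Omega -> H)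
  (k : nat -> nat) (beta : R) (M : nat -> R) :
  (* real separable Hilbert space *)
  hilbert_ip ip -> separable_H (H := H) ->
  (* rho bounded, ||rho^k|| < 1 for k >= k0 *)
  bounded_op rho ->
  (exists k0 : nat, forall j, (k0 <= j)%N -> opnorm (iter j rho) < 1) ->
  (* eps strong white noise *)
  (forall n, rand_elt ip (eps n)) ->
  indep_H P ip eps -> ident_distr P ip eps ->
  (forall n h, P.-integrable setT (fun w => (ip (eps n w) h)%:E) /\
               (\int[P]_w (ip (eps n w) h)%:E = 0)%E) ->
  (forall n, P.-integrable setT (fun w => (`|eps n w| ^+ 2)%:E)) ->
  (forall n, (0 < \int[P]_w (`|eps n w| ^+ 2)%:E)%E) ->
  (* X solves the ARH(1) equation; stationary solution (bounded second moments) *)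
  (forall n, rand_elt ip (X n)) ->
  (forall n w, X n w = rho (X (n - 1) w) + eps n w) ->
  (exists K : R, forall n, P.-integrable setT (fun w => (`|X n w| ^+ 2)%:E) /\
                           (\int[P]_w (`|X n w| ^+ 2)%:E <= K%:E)%E) ->
  (* noise uncorrelated with the past of the process *)
  (forall m n : int, m < n -> forall f g,
     (\int[P]_w (ip (X m w) f * ip (eps n w) g)%:E = 0)%E) ->
  (* C_X = E[X_0 ⊗ X_0], D_X = E[X_0 ⊗ X_1] (weakly) *)
  (forall f g, (\int[P]_w (ip (X 0 w) f * ip (X 0 w) g)%:E = (ip (CX f) g)%:E)%E) ->
  (forall f g, (\int[P]_w (ip (X 0 w) f * ip (X 1 w) g)%:E = (ip (DX f) g)%:E)%E) ->
  (* spectral decomposition of C_X (indices shifted to start at 0) *)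
  ortho_fam ip phi -> (forall j, c j.+1 <= c j) ->
  (forall x, hsum (fun j => c j *: tens ip (phi j) (phi j) x) (CX x)) ->
  (* spectral decomposition of C_n *)
  (forall n w, ortho_fam ip (fun j => phin n j w)) ->
  (forall n w j, 0 <= Cn n j.+1 w <= Cn n j w) ->
  (forall n w j, (n <= j)%N -> Cn n j w = 0) ->
  (forall n w x, hsum (fun j => Cn n j w *: tens ip (phin n j w) (phin n j w) x)
                      (Cemp ip X n w x)) ->
  (* singular value decomposition of rho *)
  ortho_fam ip psi -> ortho_fam ip psit ->
  (forall j, `|rs j.+1| <= `|rs j|) ->
  (forall j, rho (psi j) = rs j *: psit j) ->
  (forall x, hsum (fun j => rs j *: tens ip (psi j) (psit j) x) (rho x)) ->
  (* singular value decomposition of D_n C_n^{-1} *)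
  (forall n w, ortho_fam_upto ip n (fun j => psin n j w) /\ ortho_fam_upto ip n (fun j => psitn n j w)) ->
  (forall n w j, (j.+1 < n)%N -> `|rhat n j.+1 w| <= `|rhat n j w|) ->
  (forall n w j, (j < n)%N ->
     Demp ip X n w (Cinv ip Cn phin n w (psin n j w)) = rhat n j w *: psitn n j w) ->
  (forall n w h, Demp ip X n w (Cinv ip Cn phin n w h) =
     \sum_(j < n) rhat n j w *: tens ip (psin n j w) (psitn n j w) h) ->
  (* truncation parameter *)
  (forall N, exists n0, forall n, (n0 <= n)%N -> (N <= k n)%N) ->
  (forall n, (0 < n)%N -> (k n < n)%N) ->
  (* Lambda_{k_n} finite, and sqrt(k_n) Lambda_{k_n} = o(n^{1/4} / ln(n)^beta), beta > 1/2 *)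
  (forall j, c j.+1 < c j) ->
  1 / 2 < beta ->
  (fun n => Num.sqrt (k n)%:R * Lambda (k n) c * (ln n%:R) `^ beta / n%:R `^ (1 / 4))
     @ \oo --> 0 ->
  (* A1 *)
  (exists Mb : R, {ae P, forall w, `|X 0 w| < Mb}) ->
  (* A2 *)
  (forall n, (0 < k n)%N -> {ae P, forall w, 0 < Cn n (k n).-1 w}) ->
  (* A3 *)
  (forall j, 0 < c j) -> nuclear ip DX -> compact_op rho ->
  (* A4 *)
  {ae P, forall w, forall n,
     sup [set `|rs j| | j in [set: nat]] + \big[Num.max/0]_(j < n) `|rhat n j w| <= 1} ->
  (* rho is a trace operator *)
  nuclear ip rho ->
  (* ||D_n C_n^{-1} - rho|| = O(M_n) a.s. *)
  {ae P, forall w, exists C0 : R, exists n0, forall n, (n0 <= n)%N ->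
     opnorm (fun h => Demp ip X n w (Cinv ip Cn phin n w h) - rho h) <= C0 * `|M n|} ->
  (* Lambda^rho_{k_n} finite and = o(1/M_n) *)
  (forall j, `|rs j.+1| < `|rs j|) ->
  (fun n => Lambda (k n) (fun j => `|rs j| ^+ 2) * M n) @ \oo --> 0 ->
  (* conclusion *)
  {ae P, forall w,
     (fun n => \big[Num.max/0]_(j < k n)
        `|psin n j w - sgn (ip (psin n j w) (psi j)) *: psi j|) @ \oo --> 0} /\
  {ae P, forall w,
     (fun n => \big[Num.max/0]_(j < k n)
        `|psitn n j w - sgn (ip (psitn n j w) (psit j)) *: psit j|) @ \oo --> 0}.
Proof.
move=> hip _ _ _ _ _ _ _ _ _ _ _ _ _ _ _ _ _ _ _ _ _ _ opsi opsit _ _ rhoE.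
move=> opsin rhat_dec _ svdn _ kn _ _ _ _ _ _ _ _ A4 _ rateM rs_dec LM.
(* Both limits hold on one event, where A4 and the rate hold together. *)
suff : {ae P, forall w,
     (fun n => \big[Num.max/0]_(j < k n)
        `|psin n j w - sgn (ip (psin n j w) (psi j)) *: psi j|) @ \oo --> 0 /\
     (fun n => \big[Num.max/0]_(j < k n)
        `|psitn n j w - sgn (ip (psitn n j w) (psit j)) *: psit j|) @ \oo --> 0}.
  by move=> h; split; apply: filterS h => w [].
apply: filterS2 A4 rateM => w A4w [C0 [n0 rate_w]].
apply: (singular_vectors_cvg hip opsi opsit rs_dec rhoE (fun n => (opsin n w).1)
  (fun n => (opsin n w).2) _ (svdn^~ w) kn _ rate_w LM).
  by move=> n i; apply: rhat_dec.
have rs_mono : {homo (fun i => `|rs i|) : i j / (i <= j)%N >-> j <= i}.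
  by apply/nonincreasing_seqP => i; apply: ltW.
(* Each leading modulus is a member of the family in A4; the [sup] is over a bounded set because the
   moduli of [rs] decrease. *)
move=> n n_gt0; apply: le_trans (A4w n); apply: lerD.
  apply: ub_le_sup; last by exists 0%N.
  by exists `|rs 0%N| => _ [j _ <-]; apply: rs_mono.
exact: (le_bigmax _ (fun j : 'I_n => `|rhat n j w|) (Ordinal n_gt0)).
Qed.
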